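(* Let $d\in\mathbb{N}$ and let $P=\mathbb{N}_0^d$ with the componentwise partial order. If $U,V\subseteq P$ are cofinite upsets satisfying $U\subseteq V$ and $\partial\mathrm{oc}(U)\subseteq\partial\mathrm{oc}(V)$, then $U=V$.
   Context: $\mathbb{N}_0$ is the set of non-negative integers. A subset $U\subseteq P$ is an upset if $x\geq y\in U$ implies $x\in U$; it is cofinite if $P\setminus U$ is finite. For an upset $U$, $\partial\mathrm{oc}(U):=\max(P\setminus U)$ is the set of maximal elements of $P\setminus U$. *)

(* Defs.v *)
From mathcomp Require Import all_boot all_order.
From mathcomp Require Import boolp classical_sets functions cardinality.

Set Implicit Arguments.
Unset Strict Implicit.
Unset Printing Implicit Defensive.

Local Open Scope classical_set_scope.

Section Upsets.
Context {disp : Order.disp_t} {P : porderType disp}.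
Implicit Types A U : set P.

Definition upset U := forall x y : P, (y <= x)%O -> U y -> U x.

Definition cofinite U := finite_set (~` U).

Definition maximal_elements A : set P :=
  [set x | A x /\ forall y : P, A y -> (x <= y)%O -> y = x].

(* $\partial\mathrm{oc}(U)$ *)
Definition bdoc U : set P := maximal_elements (~` U).

End Upsets.

(* Main.v *)
Require Import Defs.
From mathcomp Require Import all_boot all_order.
From mathcomp Require Import boolp classical_sets functions cardinality.

Local Open Scope classical_set_scope.

(** If some [x] in [V] lay outside [U], finiteness of the complement of [U] would put a maximal
    element [m] of that complement above [x]. By [bdUV], [m] lies outside [V]; but [V] is an upset
    containing [x], so it contains [m]. The order-theoretic input is [finite_maximal_above],
    obtained by induction on a list of the elements. *)

(** Allowing [m] to be [x] itself, through [x :: s], lets the induction start at the empty list. *)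
Lemma seq_maximal_above (disp : Order.disp_t) (P : porderType disp)
    (s : seq P) (x : P) :
  exists m : P, [/\ m \in x :: s, (x <= m)%O &
    forall y : P, y \in s -> (m <= y)%O -> y = m].
Proof.
elim: s => [|a s [m [ms xm mmax]]]; first by exists x; rewrite mem_head.
have [ma|nma] := boolP (m <= a)%O.
- exists a; split; first by rewrite !inE eqxx orbT.
    exact: Order.POrderTheory.le_trans ma.
  move=> y; rewrite inE => /predU1P[//|ys] ay.
  (* From [m <= a <= y], maximality of [m] over the tail forces [y = m], hence also [y <= a]. *)
  have ym : y = m by apply: mmax => //; apply: Order.POrderTheory.le_trans ay.
  by apply: Order.POrderTheory.le_anti; rewrite ay ym ma.
- exists m; split => //.
    by move: ms; rewrite !inE => /orP[->|->]; rewrite ?orbT.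
  move=> y; rewrite inE => /predU1P[->|]; last exact: mmax.
  by rewrite (negbTE nma).
Qed.

Lemma finite_maximal_above (disp : Order.disp_t) (P : porderType disp)
    (A : set P) (x : P) :
  finite_set A -> A x -> exists2 m : P, maximal_elements A m & (x <= m)%O.
Proof.
move=> /finite_seqP[s ->] /= xs.
have [m [ms xm mmax]] := seq_maximal_above _ _ s x.
exists m => //; split; last exact: mmax.
by move: ms; rewrite inE => /predU1P[->|].
Qed.

Theorem corollary5p5 (d : nat) (hd : (0 < d)%N)
    (U V : set (d.-tupleprod nat))
    (upU : upset U) (cofU : cofinite U)
    (upV : upset V) (cofV : cofinite V)
    (UV : U `<=` V) (bdUV : bdoc U `<=` bdoc V) :
  U = V.
Proof.
apply/seteqP; split=> // x Vx; apply: contrapT => nUx.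
(* [m] is maximal outside [U], and [bdUV] carries it outside [V]. *)
have [m /bdUV[nVm _] xm] := finite_maximal_above _ _ _ _ cofU nUx.
exact: nVm (upV _ _ xm Vx).
Qed.
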